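(* Let $\mathcal{K}$ be a symmetric cone and let $x\in\mathcal{K}$. Then $$\kappa(x)=\mathrm{rank}\,x .$$
   Context: A closed convex cone $\mathcal{K}$ in a finite-dimensional real inner product space is a symmetric cone if $\mathcal{K}=\mathcal{K}^*$ (where $\mathcal{K}^*=\{x\mid\langle x,y\rangle\geq0\ \forall y\in\mathcal{K}\}$), $\mathrm{int}\,\mathcal{K}\neq\emptyset$, and for all $x,y\in\mathrm{int}\,\mathcal{K}$ there is an invertible linear map $T$ with $T(\mathcal{K})=\mathcal{K}$ and $T(x)=y$. A Euclidean Jordan algebra is a finite-dimensional real inner product space $\mathcal{E}$ with a bilinear product $\circ:\mathcal{E}\times\mathcal{E}\to\mathcal{E}$ such that, writing $x^2=x\circ x$, one has $x\circ y=y\circ x$, $x\circ(x^2\circ y)=x^2\circ(x\circ y)$ and $\langle x\circ y,z\rangle=\langle y,x\circ z\rangle$ for all $x,y,z\in\mathcal{E}$. It is known that a cone is symmetric if and only if it is the cone of squares $\mathcal{K}=\{z\circ z\mid z\in\mathcal{E}\}$ of some Euclidean Jordan algebra $(\mathcal{E},\circ)$, which may be taken to have an identity element $e$; such an algebra is fixed for $\mathcal{K}$. An element $c$ is idempotent if $c\circ c=c$; it is a primitive idempotent if moreover it is nonzero and cannot be written as $c=a+b$ with $a,b$ nonzero idempotents satisfying $a\circ b=0$. By the spectral theorem, there is an integer $r$ depending only on $\mathcal{E}$ such that every $x\in\mathcal{E}$ can be written as $x=\sum_{i=1}^r\lambda_ic_i$ where $c_1,\ldots,c_r$ are primitive idempotents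 with $c_i\circ c_j=0$ for $i\neq j$ and $c_1+\cdots+c_r=e$, and the real numbers $\lambda_1,\ldots,\lambda_r$ (the eigenvalues of $x$, with multiplicity) are uniquely determined by $x$ up to order. The rank of $x$, $\mathrm{rank}\,x$, is the number of nonzero $\lambda_i$. An extreme ray of $\mathcal{K}$ is a one-dimensional face of $\mathcal{K}$ (a face is a convex subset $\mathcal{F}\subseteq\mathcal{K}$ such that $u,v\in\mathcal{K}$ and $\alpha u+(1-\alpha)v\in\mathcal{F}$ for some $0<\alpha<1$ imply $u,v\in\mathcal{F}$). For $x\in\mathcal{K}$, $\kappa(x)$ is the smallest nonnegative integer $k$ such that $x=d_1+\cdots+d_k$ with each $d_i$ belonging to an extreme ray of $\mathcal{K}$ (the empty sum is $0$). *)

(* Defs.v *)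
From HB Require Import structures.
From mathcomp Require Import all_boot all_order all_algebra.
From mathcomp Require Import all_classical all_reals all_analysis.

Set Implicit Arguments.
Unset Strict Implicit.
Unset Printing Implicit Defensive.

Import Order.TTheory GRing.Theory Num.Theory.
Import numFieldNormedType.Exports.

Local Open Scope classical_set_scope.
Local Open Scope ring_scope.

(* Finite-dimensional real inner product spaces.  The norm, hence the topology
   used for [closed] and [interior], is the one induced by the inner product. *)
HB.mixin Record NormedModule_hasInner (R : realType) V
    of NormedModule R V & Vector R V := {
  inner : {dot V for idfun} ;
  norm_inner : forall x : V, `|x| = Num.sqrt (inner x x)
}.

#[short(type="euclideanType")]
HB.structure Definition Euclidean (R : realType) :=
  {V of NormedModule_hasInner R V & NormedModule R V & Vector R V}.

Section Cones.
Context {R : realType} {E : euclideanType R}.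
Implicit Types (K F : set E) (x y u v : E).

Definition dual_cone K : set E :=
  [set x | forall y, K y -> 0 <= inner x y].

Definition convex_cone K : Prop :=
  convex_set K /\ forall (a : R) x, 0 <= a -> K x -> K (a *: x).

Definition homogeneous K : Prop :=
  forall x y, interior K x -> interior K y ->
  exists T : {linear E -> E}, [/\ bijective T, T @` K = K & T x = y].

Definition symmetric_cone K : Prop :=
  [/\ closed K, convex_cone K, K = dual_cone K, interior K !=set0
    & homogeneous K].

Definition face K F : Prop :=
  [/\ convex_set F, F `<=` K
    & forall u v (a : R), K u -> K v -> 0 < a -> a < 1 ->
        F (a *: u + (1 - a) *: v) -> F u /\ F v].

(* [F] is nonempty and the direction space of its affine hull, i.e. the least
   subspace containing all differences of points of [F], has dimension [n]. *)
Definition affine_dim F (n : nat) : Prop :=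
  F !=set0 /\ exists U : {vspace E},
    [/\ \dim U = n,
        forall u v, F u -> F v -> u - v \in U
      & forall W : {vspace E},
          (forall u v, F u -> F v -> u - v \in W) -> (U <= W)%VS].

Definition extreme_ray K F : Prop := face K F /\ affine_dim F 1.

Definition extreme_sum K x (k : nat) : Prop :=
  exists d : 'I_k -> E,
    (forall i, exists F, extreme_ray K F /\ F (d i)) /\ x = \sum_(i < k) d i.

(* The default 0 is returned when [x] is no sum of elements of extreme rays. *)
Definition kappa K x : nat :=
  xget 0%N [set k | extreme_sum K x k /\
                  forall m, extreme_sum K x m -> (k <= m)%N].

End Cones.

Section JordanAlgebras.
Context {R : realType} {E : euclideanType R}.
Implicit Types (jmul : {bilinear E -> E -> E}) (e x y z c : E).

Definition euclidean_jordan jmul : Prop :=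
  [/\ forall x y, jmul x y = jmul y x,
      forall x y, jmul x (jmul (jmul x x) y) = jmul (jmul x x) (jmul x y)
    & forall x y z, inner (jmul x y) z = inner y (jmul x z)].

Definition jordan_identity jmul e : Prop := forall x, jmul e x = x.

Definition cone_of_squares jmul : set E := range (fun z => jmul z z).

Definition idempotent_elt jmul c : Prop := jmul c c = c.

Definition primitive_idempotent jmul c : Prop :=
  [/\ idempotent_elt jmul c, c != 0
    & ~ exists a b, [/\ idempotent_elt jmul a /\ a != 0,
                        idempotent_elt jmul b /\ b != 0,
                        jmul a b = 0 & c = a + b]].

Definition jordan_frame jmul e r (c : 'I_r -> E) : Prop :=
  [/\ forall i, primitive_idempotent jmul (c i),
      forall i j, i != j -> jmul (c i) (c j) = 0
    & \sum_(i < r) c i = e].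

Definition spectral_values jmul e x (l : seq R) : Prop :=
  exists c : 'I_(size l) -> E,
    jordan_frame jmul e c /\ x = \sum_(i < size l) l`_i *: c i.

(* The eigenvalues of [x] with multiplicity, in an arbitrary order: by the
   spectral theorem such a list exists and is unique up to permutation. *)
Definition eigenvalues jmul e x : seq R :=
  xget [::] [set l | spectral_values jmul e x l].

Definition jordan_rank jmul e x : nat :=
  count (fun t => t != 0) (eigenvalues jmul e x).

End JordanAlgebras.

(* Main.v *)
Require Import Defs.
From HB Require Import structures.
From mathcomp Require Import all_boot all_order all_algebra.
From mathcomp Require Import all_classical all_reals all_analysis.
From mathcomp Require Import complex ring lra.

(** Write the spectral decomposition of [x] as a sum of l_i c_i.  Since [x] is in
    the cone, each l_i is nonnegative; and a primitive idempotent spans an extreme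
    ray ([ray_extreme]), so [x] is a sum of as many extreme elements as it has
    nonzero eigenvalues ([extreme_sum_rank]).  Conversely an extreme element is,
    by its own spectral decomposition, a multiple of one primitive idempotent
    ([extreme_multiple]).  What remains is that [x] is no sum of multiples of m
    primitive idempotents d_1, ..., d_m when it has more than m nonzero
    eigenvalues ([rank_le_extreme_sum]).

    The reason is a dimension count by orthogonality.  Let p be the sum of the c_i
    with nonzero l_i.  If there are more than m of them, there is a primitive
    idempotent z below p orthogonal to every d_j ([frame_avoid]).  So z is
    orthogonal to [x], which is impossible because [x] is positive on p.  For
    symmetric matrices, z is the projection on a vector orthogonal to m given
    vectors inside a space of dimension larger than m.

    To find z, one d is treated at a time, by rotating the orthogonal family
    c_1, ..., c_N into another one with the same sum in which all members but one
    are orthogonal to d ([frame_sweep]).  It is enough to rotate two members a, b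
    ([rank2_diag]): diagonalize the projection of d on the Peirce space E_1(a + b)
    as k f + l g.  Because E_1(d) is a line, the product <f, d> <g, d> is
    proportional to the off-diagonal part of d with respect to f and g.  That part
    is zero, so f or g is orthogonal to d.  That f and g are again primitive
    holds because each element of E_1(a + b) satisfies a quadratic equation
    ([rank2_quad]).  With this argument neither the invariance of the size of
    Jordan frames nor the uniqueness of the eigenvalues has to be known.

    The spectral theorem ([spectral_peirce1]) is obtained by splitting idempotents:
    the algebra generated by one element x is associative, so a real root of a
    polynomial annihilating x yields an idempotent that is an eigenvector of x
    ([eigen_idempotent]). *)

Set Implicit Arguments.
Unset Strict Implicit.
Unset Printing Implicit Defensive.

Import Order.TTheory GRing.Theory Num.Theory.

Local Open Scope classical_set_scope.
Local Open Scope ring_scope.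

(** * Real polynomials *)

(** A complex root of [p] is either real, giving a linear factor, or comes with
    its conjugate, giving a quadratic factor that is positive on the real line. *)
Lemma real_poly_factor (R : rcfType) (p : {poly R}) : size p != 1%N ->
  exists g : {poly R}, (exists k, p = g * ('X - k%:P)) \/
    (exists a b, b != 0 /\ p = g * (('X - a%:P) ^+ 2 + (b ^+ 2)%:P)).
Proof.
rewrite -(size_map_poly (real_complex R)) => /closed_rootP [[a b]].
have [->|b0] := eqVneq b 0.
  rewrite (_ : Complex a 0 = real_complex R a) // fmorph_root => /factor_theorem [g ->].
  by exists g; left; exists a.
set m : {poly R} := ('X - a%:P) ^+ 2 + (b ^+ 2)%:P.
have sm : size m = 3%N.
  by rewrite size_polyDl size_exp_XsubC // (leq_ltn_trans (size_polyC_leq1 _)).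
move=> rp; exists (p %/ m); right; exists a, b; split=> //; rewrite -/m.
rewrite {1}(divp_eq p m);
(* The remainder has degree at most one and vanishes at the nonreal number
   a + i b, so it is zero. *)
suff -> : p %% m = 0 by rewrite addr0.
have m0 : m != 0 by rewrite -size_poly_gt0 sm.
have sr : (size (p %% m)%R <= 2)%N by rewrite -ltnS -sm ltn_modp.
move: rp; rewrite {1}(divp_eq p m) rmorphD rmorphM /= rootE hornerD hornerM.
have -> : (map_poly (real_complex R) m).[Complex a b] = 0.
  rewrite /m rmorphD rmorphXn rmorphB /= map_polyX !map_polyC /= !hornerE /=.
  by simpc; apply/eqP; rewrite eq_complex /=; apply/andP; split; apply/eqP; ring.
set r := p %% m; rewrite mulr0 add0r.
have rE : r = (r`_0)%:P + (r`_1)%:P * 'X.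
  apply/polyP => -[|[|i]]; rewrite coefD coefCM coefX coefC /= ?mulr0 ?mulr1 ?addr0 ?add0r //.
  by rewrite nth_default // (leq_trans sr).
rewrite {1}rE rmorphD rmorphM /= map_polyX !map_polyC /= !hornerE /=.
simpc; rewrite eq_complex /= mulf_eq0 (negPf b0) orbF => /andP[h1 /eqP h2].
move: h1; rewrite h2 mul0r addr0 => /eqP h1.
by rewrite rE h1 h2 mul0r addr0.
Qed.

(** * The inner product *)

Section Inner.
Context {R : realType} {E : euclideanType R}.
Implicit Types x y z : E.

Lemma innerC x y : inner x y = inner y x.
Proof. by have := hermC inner x y; rewrite /= expr0 mul1r. Qed.
Lemma innerDl x y z : inner (x + y) z = inner x z + inner y z.
Proof. exact: linearDl. Qed.
Lemma innerNl x z : inner (- x) z = - inner x z.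
Proof. exact: linearNl. Qed.
Lemma innerZl a x z : inner (a *: x) z = a * inner x z.
Proof. exact: linearZl_LR. Qed.
Lemma inner0l z : inner 0 z = 0.
Proof. exact: linear0l. Qed.
Lemma innerDr x y z : inner x (y + z) = inner x y + inner x z.
Proof. by rewrite !(innerC x) innerDl. Qed.
Lemma innerNr x z : inner x (- z) = - inner x z.
Proof. by rewrite !(innerC x) innerNl. Qed.
Lemma innerZr a x z : inner x (a *: z) = a * inner x z.
Proof. by rewrite !(innerC x) innerZl. Qed.
Lemma inner0r z : inner z 0 = 0.
Proof. by rewrite innerC inner0l. Qed.
Lemma inner_gt0 x : x != 0 -> 0 < inner x x.
Proof. exact: neq0_dnorm_gt0. Qed.
Lemma inner_ge0 x : 0 <= inner x x.
Proof. by have [->|/inner_gt0/ltW//] := eqVneq x 0; rewrite inner0l. Qed.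
Lemma inner_eq0 x : (inner x x == 0) = (x == 0).
Proof.
have [->|/inner_gt0 h] := eqVneq x 0; first by rewrite inner0l eqxx.
by rewrite gt_eqF.
Qed.
Lemma inner_sumr I r (P : pred I) (f : I -> E) z :
  inner z (\sum_(i <- r | P i) f i) = \sum_(i <- r | P i) inner z (f i).
Proof. by apply: (big_morph _ (innerDr z) (inner0r z)). Qed.

(** Vector identities are proved below by pairing both sides with an arbitrary
    [t], which turns them into linear identities between real numbers. *)
Lemma inner_inj x y : (forall t, inner x t = inner y t) -> x = y.
Proof.
by move=> h; apply/eqP; rewrite -subr_eq0 -inner_eq0 innerDl innerNl h subrr.
Qed.

Definition innerE :=
  (@innerDl, @innerDr, @innerNl, @innerNr, @innerZl, @innerZr, @inner0l, @inner0r).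

End Inner.

(** * Jordan multiplication and its partial linearizations *)

Section EuclideanJordan.
Context {R : realType} {E : euclideanType R} {jmul : {bilinear E -> E -> E}}.
Context (ejaE : euclidean_jordan jmul).
Implicit Types (a b c d e f g u v w x y z : E).
Local Notation "x ** y" := (jmul x y) (at level 40, left associativity).

Lemma jmulC x y : x ** y = y ** x.
Proof. by case: ejaE. Qed.
Lemma jordan x y : x ** ((x ** x) ** y) = (x ** x) ** (x ** y).
Proof. by case: ejaE. Qed.
Lemma jmul_adj x y z : inner (x ** y) z = inner y (x ** z).
Proof. by case: ejaE. Qed.

Lemma jmulDr x y z : x ** (y + z) = x ** y + x ** z.
Proof. exact: linearDr. Qed.
Lemma jmulDl x y z : (x + y) ** z = x ** z + y ** z.
Proof. exact: linearDl. Qed.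
Lemma jmulNr x y : x ** (- y) = - (x ** y).
Proof. exact: linearNr. Qed.
Lemma jmulNl x y : (- x) ** y = - (x ** y).
Proof. exact: linearNl. Qed.
Lemma jmulZr (k : R) x y : x ** (k *: y) = k *: (x ** y).
Proof. exact: linearZr_LR. Qed.
Lemma jmulZl (k : R) x y : (k *: x) ** y = k *: (x ** y).
Proof. exact: linearZl_LR. Qed.
Lemma jmul0r x : x ** 0 = 0.
Proof. exact: linear0r. Qed.
Lemma jmul0l x : 0 ** x = 0.
Proof. exact: linear0l. Qed.
Definition jmulE :=
  (jmulDr, jmulDl, jmulNr, jmulNl, jmulZr, jmulZl, jmul0r, jmul0l).

Lemma jmul_sumr I r (P : pred I) (F : I -> E) z :
  z ** (\sum_(i <- r | P i) F i) = \sum_(i <- r | P i) z ** F i.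
Proof. exact: (big_morph _ (jmulDr z) (jmul0r z)). Qed.

(** The part of degree one in [x] of the Jordan identity at [y + x]: comparing
    [y + x] with [y - x] leaves the parts of degree one and three in [x], and the
    latter is the identity at [x].
    Read as operators in [w], it says that multiplication by [x] and by [y ** y]
    commute up to the commutator of those by [y] and by [x ** y]. *)
Lemma jordan_lin x y w :
  x ** ((y ** y) ** w) + 2 *: (y ** ((x ** y) ** w))
  = (y ** y) ** (x ** w) + 2 *: ((x ** y) ** (y ** w)).
Proof.
apply: inner_inj => t.
have := congr1 (inner ^~ t) (jordan (y + x) w).
have := congr1 (inner ^~ t) (jordan (y - x) w).
have := congr1 (inner ^~ t) (jordan x w).
rewrite /= !(jmulE, innerE) (jmulC y x).
lra.
Qed.

(** The right-hand side of [jordan_lin] is symmetric in [x] and [w], hence so is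
    its left-hand side.  Read as operators in [x], this expresses the
    multiplication by [(y ** y) ** w] through those by [y], [w], [y ** y] and
    [y ** w]. *)
Lemma jordan_op x y w :
  ((y ** y) ** w) ** x + 2 *: (y ** (w ** (y ** x)))
  = w ** ((y ** y) ** x) + 2 *: (y ** ((y ** w) ** x)).
Proof.
apply: inner_inj => t.
have := congr1 (inner ^~ t) (jordan_lin x y w).
have := congr1 (inner ^~ t) (jordan_lin w y x).
rewrite /= (jmulC w x) (jmulC w y) (jmulC y x) (jmulC w (x ** y)).
rewrite (jmulC (y ** y ** w) x) (jmulC (y ** w) (x ** y)) (jmulC (y ** w) x).
rewrite !(jmulE, innerE); lra.
Qed.

(** * Peirce spaces of an idempotent *)

Local Notation idem := (idempotent_elt jmul).

(** The eigenspaces of multiplication by an idempotent [c] for the eigenvalues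
    1 and 0 are the Peirce spaces E_1(c) and E_0(c).  They appear below as the
    equations [c ** a = a] and [c ** b = 0].  Multiplication by an element of
    either space commutes with multiplication by [c]. *)
Lemma peirce1_comm c a w : idem c -> c ** a = a -> c ** (a ** w) = a ** (c ** w).
Proof.
move=> cc ca; apply: inner_inj => t.
have := congr1 (inner ^~ t) (jordan_lin a c w).
rewrite /= cc (jmulC a c) ca !innerE; lra.
Qed.

Lemma peirce0_comm c b w : idem c -> c ** b = 0 -> c ** (b ** w) = b ** (c ** w).
Proof.
move=> cc cb; have := jordan_lin b c w.
by rewrite cc (jmulC b c) cb !jmulE !scaler0 !addr0.
Qed.

(** E_1(c) and E_0(c) annihilate each other: [a ** b] is in both spaces, since
    multiplication by [c] commutes with those by [a] and by [b]. *)
Lemma peirce10 c a b : idem c -> c ** a = a -> c ** b = 0 -> a ** b = 0.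
Proof.
move=> cc ca cb.
have := peirce0_comm a cc cb; rewrite ca (jmulC b a) => <-.
by rewrite peirce1_comm // cb jmul0r.
Qed.

Lemma peirce1_mul c a b : idem c -> c ** a = a -> c ** b = b -> c ** (a ** b) = a ** b.
Proof. by move=> cc ca cb; rewrite peirce1_comm // cb. Qed.

(** Multiplication by an idempotent is annihilated by t (2t - 1) (t - 1), so its
    eigenvalues are 0, 1/2 and 1. *)
Lemma peirce_poly c w : idem c ->
  c ** (c ** (c ** w)) = (3 / 2) *: (c ** (c ** w)) - 2^-1 *: (c ** w).
Proof.
move=> cc; apply: inner_inj => t.
have := congr1 (inner ^~ t) (jordan_op w c c).
rewrite /= !cc !innerE; lra.
Qed.

(** The polynomial 2 t^2 - t is 1 at 1 and vanishes at 0 and 1/2: it gives the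
    projection onto E_1(c). *)
Lemma peirce1_proj c w : idem c ->
  c ** (2 *: (c ** (c ** w)) - c ** w) = 2 *: (c ** (c ** w)) - c ** w.
Proof.
move=> cc; rewrite !jmulE peirce_poly //.
by apply: inner_inj => t; rewrite !innerE; lra.
Qed.

(** With w_1 and w_h the Peirce components of [w] for the eigenvalues 1 and 1/2,
    this is the identity <w, c w> = |w_1|^2 + 1/2 |w_h|^2: they are
    w_1 = 2 c (c w) - c w and w_h = 4 (c w - c (c w)). *)
Lemma idem_quad c w : idem c ->
  inner w (c ** w) = inner (2 *: (c ** (c ** w)) - c ** w) (2 *: (c ** (c ** w)) - c ** w)
   + 8 * inner (c ** w - c ** (c ** w)) (c ** w - c ** (c ** w)).
Proof.
move=> cc; set a := c ** w; set b := c ** a.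
have cb : c ** b = (3 / 2) *: b - 2^-1 *: a by exact: peirce_poly.
have A2 : inner a a = inner w b by rewrite {1}/a jmul_adj.
have A3 : inner a b = inner w (c ** b) by rewrite {1}/a jmul_adj.
have A4 : inner b b = inner a (c ** b) by rewrite {1}/b jmul_adj.
move: A3 A4; rewrite cb !innerE (innerC b a) => A3 A4.
lra.
Qed.

Lemma idem_ge0 c w : idem c -> 0 <= inner w (c ** w).
Proof.
move=> /(idem_quad w) ->.
by rewrite addr_ge0 ?mulr_ge0 ?inner_ge0.
Qed.

Lemma idem_inner0 c w : idem c -> inner w (c ** w) = 0 -> c ** w = 0.
Proof.
move=> cc /eqP; rewrite idem_quad // paddr_eq0 ?mulr_ge0 ?inner_ge0 //.
rewrite mulf_eq0 pnatr_eq0 /= !inner_eq0 => /andP[/eqP h1 /eqP h2].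
apply: inner_inj => t.
have := congr1 (inner ^~ t) h1; have := congr1 (inner ^~ t) h2.
rewrite /= !innerE; lra.
Qed.

(** On the image of the product of the multiplications by two orthogonal
    idempotents, each of them acts as 1/2: this image is the Peirce space E_fg. *)
Lemma orth_half f g w : idem f -> f ** g = 0 ->
  f ** (f ** (g ** w)) = 2^-1 *: (f ** (g ** w)).
Proof.
move=> ff fg.
have := jordan_op w f g; rewrite ff fg !jmulE scaler0 addr0 add0r.
rewrite -(peirce0_comm w ff fg) => h.
by rewrite -[in RHS]h scalerA mulVf ?pnatr_eq0 // scale1r.
Qed.

(** * An eigen-idempotent of every element *)

(** Let [x] be in E_1(q).  The powers of [x], with [q] as its power of exponent
    zero, span an associative algebra.  An eigenvector of [x] in this algebra is,
    up to scaling, an idempotent. *)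
Section Powers.
Context (q x : E) (qq : idem q) (qx : q ** x = x).
Definition jpow n : E := iter n (jmul x) q.

Lemma jpow1 n : q ** jpow n = jpow n.
Proof. by elim: n => [|n IH] //=; rewrite peirce1_mul. Qed.

(** Multiplication by [y] commutes with those by [x] and [x ** x].  Both are
    carried through the induction, since [jordan_op] writes multiplication by
    the next power in terms of these two. *)
Definition comm_powers y := (forall w, x ** (y ** w) = y ** (x ** w)) /\
   (forall w, (x ** x) ** (y ** w) = y ** ((x ** x) ** w)).

Lemma comm_powers_step y : q ** y = y -> comm_powers y -> comm_powers (x ** y) ->
  comm_powers (x ** (x ** y)).
Proof.
move=> qy [IH1 IH2] [IH3 IH4].
have e0 : x ** (x ** y) = (x ** x) ** y.
  rewrite -qy (jmulC q y) IH1 IH1 IH2 (jmulC x q) qx.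
  by rewrite (jmulC (x ** x) q) (peirce1_mul qq qx qx).
have e w : (x ** (x ** y)) ** w = y ** ((x ** x) ** w) + 2 *: (x ** ((x ** y) ** w))
    - 2 *: (x ** (y ** (x ** w))).
  by rewrite e0; apply/eqP; rewrite eq_sym subr_eq eq_sym; apply/eqP; exact: jordan_op.
split=> w; rewrite !e !jmulE.
  by rewrite (IH1 ((x ** x) ** w)) (IH3 w) (IH1 (x ** w)) jordan.
by rewrite (IH2 ((x ** x) ** w)) -!jordan (IH4 w) (IH2 (x ** w)) -jordan.
Qed.

Lemma jpow_comm n : comm_powers (jpow n).
Proof.
suff: comm_powers (jpow n) /\ comm_powers (jpow n.+1) by case.
elim: n => [|n [IH1 IH2]]; last by split=> //; apply: comm_powers_step => //; exact: jpow1.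
split; split=> w.
- by rewrite -[LHS](peirce1_comm w qq qx).
- exact/esym/(peirce1_comm w qq)/peirce1_mul.
- by rewrite [jpow 1]jmulC qx.
- by rewrite [jpow 1]jmulC qx jordan.
Qed.

Lemma jpowM i j : jpow i ** jpow j = iter i (jmul x) (jpow j).
Proof.
elim: j => [|j IH]; first by rewrite /= jmulC jpow1.
by rewrite /= -(jpow_comm i).1 IH -iterSr.
Qed.

Definition jeval (p : {poly R}) : E := \sum_(i < size p) p`_i *: jpow i.

Lemma jeval_wide n (p : {poly R}) : (size p <= n)%N -> jeval p = \sum_(i < n) p`_i *: jpow i.
Proof.
move=> pn; rewrite /jeval (big_ord_widen _ (fun i => p`_i *: jpow i) pn).
rewrite big_mkcond; apply: eq_bigr => i _; case: ltnP => // h.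
by rewrite nth_default // scale0r.
Qed.

Lemma jevalD (p g : {poly R}) : jeval (p + g) = jeval p + jeval g.
Proof.
have le := leq_maxl (size p) (size g); have le' := leq_maxr (size p) (size g).
rewrite (jeval_wide (size_polyD p g)) (jeval_wide le) (jeval_wide le') -big_split.
by apply: eq_bigr => i _; rewrite coefD scalerDl.
Qed.

Lemma jevalZ k (p : {poly R}) : jeval (k *: p) = k *: jeval p.
Proof.
rewrite (jeval_wide (size_scale_leq k p)) scaler_sumr.
by apply: eq_bigr => i _; rewrite coefZ scalerA.
Qed.

Lemma jevalMXsubC (p : {poly R}) k : jeval (p * ('X - k%:P)) = x ** jeval p - k *: jeval p.
Proof.
rewrite (@jeval_wide (size p).+1); last first.
  by apply: leq_trans (size_polyMleq _ _) _; rewrite size_XsubC addn2.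
rewrite mulrBr; under eq_bigr do rewrite coefB coefMC coefMX scalerBl.
rewrite sumrB; congr (_ - _); last first.
  rewrite (@jeval_wide (size p).+1) // scaler_sumr.
  by apply: eq_bigr => i _; rewrite scalerA mulrC.
rewrite big_ord_recl /= scale0r add0r jmul_sumr.
by apply: eq_bigr => i _; rewrite jmulZr.
Qed.

Lemma jevalM_eigen (p g : {poly R}) k : x ** jeval g = k *: jeval g ->
  jeval p ** jeval g = p.[k] *: jeval g.
Proof.
move=> xy; rewrite horner_coef scaler_suml jmulC jmul_sumr.
apply: eq_bigr => i _; rewrite jmulZr -scalerA; congr (_ *: _).
rewrite jmulC.
have -> : jpow i ** jeval g = iter i (jmul x) (jeval g).
  rewrite [X in iter _ _ X]/jeval /jeval jmul_sumr.
  under eq_bigr do rewrite jmulZr jpowM.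
  elim: (nat_of_ord i) => [|m IH] //=; rewrite -IH jmul_sumr.
  by apply: eq_bigr => j _; rewrite jmulZr.
elim: (nat_of_ord i) => [|m IH] /=; first by rewrite expr0 scale1r.
by rewrite IH jmulZr xy scalerA exprSr.
Qed.

Lemma jeval_annihilator : exists2 p : {poly R}, p != 0 & jeval p = 0.
Proof.
pose n := \dim {: E}.
have : ~~ free [tuple jpow i | i < n.+1].
  apply/negP; rewrite /free size_tuple => /eqP h.
  by have := dimvS (subvf <<[tuple jpow i | i < n.+1]>>%VS); rewrite h ltnn.
move=> nf; apply: contrapT => H; move/negP: nf; apply; apply/freeP => k k0 i.
apply: contrapT => /eqP ki; apply: H.
exists (\poly_(i < n.+1) k (inord i)).
  apply/eqP => /(congr1 (fun p : {poly R} => p`_i)).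
  by rewrite coef_poly ltn_ord inord_val coef0; apply/eqP.
rewrite (@jeval_wide n.+1) ?size_poly // -[RHS]k0.
apply: eq_bigr => j _; rewrite coef_poly ltn_ord inord_val.
by rewrite -tnth_nth tnth_mktuple.
Qed.

(** In a factorization of an annihilating polynomial [p], a quadratic factor
    without real roots can be dropped: multiplication by [x] is self-adjoint, so
    ((x - a)^2 + b^2) y = 0 gives |(x - a) y|^2 + b^2 |y|^2 = 0 and y = 0.  Thus
    either a linear factor produces an eigenvector, or the cofactor [g] is an
    annihilating polynomial of smaller degree. *)
Lemma jeval_eigen (p : {poly R}) : q != 0 -> p != 0 -> jeval p = 0 ->
  exists (g : {poly R}) k, jeval g != 0 /\ x ** jeval g = k *: jeval g.
Proof.
move=> q0; have [n] := ubnP (size p); elim: n p => // n IH p.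
rewrite ltnS => pn p0 ep.
have sp : size p != 1%N.
  apply: contraNneq q0 => /eqP/size_poly1P[c c0 pE]; move: ep.
  rewrite pE (@jeval_wide 1) ?size_polyC_leq1 // big_ord1 coefC /=.
  by move/eqP; rewrite scaler_eq0 (negPf c0).
have [g [[k pE]|[a [b [b0 pE]]]]] := real_poly_factor sp.
  have [g0|g0] := eqVneq (jeval g) 0; last first.
    exists g, k; split=> //; apply/eqP; rewrite -subr_eq0 -jevalMXsubC -pE.
    exact/eqP.
  have gn0 : g != 0 by apply: contraNneq p0 => g_0; rewrite pE g_0 mul0r.
  apply: (IH g) => //; apply: leq_trans pn.
  by rewrite pE size_Mmonic ?monicXsubC // size_XsubC addn2.
have [g0|g0] := eqVneq (jeval g) 0; last first.
  suff: ~~ (0 < inner (jeval g) (jeval g)) by rewrite inner_gt0.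
  set y := jeval g in g0 *.
  have [z zE] : exists z, z = x ** y - a *: y by exists (x ** y - a *: y).
  have e : x ** z - a *: z + (b ^+ 2) *: y = 0.
    rewrite -ep pE mulrDr [g * _%:P]mulrC mul_polyC jevalD jevalZ.
    by rewrite expr2 mulrA !jevalMXsubC -zE.
  have := congr1 (inner ^~ y) e; rewrite /= !innerE jmul_adj.
  have zz : inner z (x ** y) - a * inner z y = inner z z.
    by rewrite -innerZr -innerNr -innerDr -zE.
  rewrite zz => e2.
  have b2 : 0 < b ^+ 2 by rewrite exprn_even_gt0.
  have := inner_ge0 z; rewrite -leNgt => h.
  by rewrite -(pmulr_rle0 _ b2); lra.
have gn0 : g != 0 by apply: contraNneq p0 => g_0; rewrite pE g_0 mul0r.
have sb : (size (b ^+ 2)%:P < 3)%N by exact: leq_ltn_trans (size_polyC_leq1 _) _.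
apply: (IH g) => //; apply: leq_trans pn.
rewrite pE size_Mmonic //.
  by rewrite size_polyDl size_exp_XsubC // addnS /= addnS ltnS leq_addr.
by rewrite monicE lead_coefDl ?size_exp_XsubC // lead_coef_exp lead_coefXsubC expr1n.
Qed.

(** An eigenvector [y = g(x)] satisfies y y = g(k) y, and g(k) is nonzero because
    <q, y y> = |y|^2.  So [y] divided by g(k) is idempotent. *)
Lemma eigen_idempotent : q != 0 ->
  exists a k, [/\ idem a, a != 0, q ** a = a & x ** a = k *: a].
Proof.
move=> q0; have [p p0 ep] := jeval_annihilator.
have [g [k [g0 xg]]] := jeval_eigen q0 p0 ep.
have gg := jevalM_eigen g xg; set m := g.[k] in gg.
have qg : q ** jeval g = jeval g.
  by rewrite jmul_sumr; apply: eq_bigr => i _; rewrite jmulZr jpow1.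
have m0 : m != 0.
  apply: contraNneq g0 => m0; rewrite -inner_eq0 -{2}qg -jmul_adj.
  by rewrite jmulC jmul_adj gg m0 scale0r inner0r.
exists (m^-1 *: jeval g), k; split.
- by rewrite /idempotent_elt !jmulE gg !scalerA -mulrA mulVf // mulr1.
- by rewrite scaler_eq0 invr_eq0 negb_or m0.
- by rewrite jmulE qg.
- by rewrite jmulE xg !scalerA mulrC.
Qed.

End Powers.

(** * Primitive idempotents, frames and the spectral theorem *)

Lemma idem_compl q a : idem q -> idem a -> q ** a = a ->
  [/\ idem (q - a), a ** (q - a) = 0 & q ** (q - a) = q - a].
Proof.
rewrite /idempotent_elt => qq aa qa; split; rewrite !jmulE ?aa ?qq ?(jmulC a q) ?qa ?subrr //.
by apply: inner_inj => t; rewrite !innerE; lra.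
Qed.

(** If [a] is below [q] then E_1(a) is contained in E_1(q), because E_1(a) is
    annihilated by [q - a], an element of E_0(a). *)
Lemma peirce1_sub q a y : idem q -> idem a -> q ** a = a -> a ** y = y -> q ** y = y.
Proof.
move=> qq aa qa ay; have [_ h _] := idem_compl qq aa qa.
have := peirce10 aa ay h; rewrite !jmulE => /eqP; rewrite subr_eq0.
by rewrite (jmulC y a) ay (jmulC y q) => /eqP.
Qed.

(** The eigen-idempotent of [x] inside E_1(c) has to be [c] itself, for it would
    split [c] otherwise. *)
Lemma primitive_peirce1 c x : primitive_idempotent jmul c -> c ** x = x ->
  exists k, x = k *: c.
Proof.
move=> [cc c0 cn] cx; have [a [k [aa a0 ca xa]]] := eigen_idempotent cc cx c0.
exists k; have [ac|ac] := eqVneq a c; first by rewrite -ac -xa ac jmulC.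
have [h1 h2 _] := idem_compl cc aa ca.
case: cn; exists a, (c - a); split=> //; first by split=> //; rewrite subr_eq0 eq_sym.
by rewrite addrC subrK.
Qed.

(** Unlike a Jordan frame, a frame here may have any sum. *)
Definition frame (s : seq E) := (forall c, c \in s -> primitive_idempotent jmul c) /\
  pairwise (fun a b => a ** b == 0) s.

Lemma frame_cons c s : frame (c :: s) <->
  [/\ primitive_idempotent jmul c, forall d, d \in s -> c ** d = 0 & frame s].
Proof.
rewrite /frame pairwise_cons; split=> [[h /andP[/allP h1 h2]]|[h1 h2 [h3 h4]]].
  split; [exact/h/mem_head| by move=> d /h1/eqP| split=> // d ds].
  by apply: h; rewrite in_cons ds orbT.
split; first by move=> d; rewrite in_cons => /orP[/eqP->|/h3].
by rewrite h4 andbT; apply/allP => d /h2 ->.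
Qed.

Lemma orth_sum0 c s : (forall d, d \in s -> c ** d = 0) -> c ** (\sum_(d <- s) d) = 0.
Proof. by move=> h; rewrite jmul_sumr big1_seq // => d /andP[_ /h]. Qed.

Lemma frame_sum s : frame s -> idem (\sum_(c <- s) c) /\
  forall d, d \in s -> (\sum_(c <- s) c) ** d = d.
Proof.
elim: s => [|c s IH]; first by rewrite big_nil /idempotent_elt jmul0l.
case/frame_cons => -[cc _ _] h /IH[IH1 IH2]; rewrite big_cons.
have c0 := orth_sum0 h; rewrite /idempotent_elt; split=> [|d].
  by rewrite !jmulE cc IH1 (jmulC _ c) !c0 addr0 add0r.
rewrite in_cons jmulDl => /orP[/eqP->|ds]; last by rewrite IH2 // h // add0r.
by rewrite cc jmulC c0 addr0.
Qed.

Lemma frame_cat s t : frame s -> frame t ->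
  (\sum_(c <- s) c) ** (\sum_(c <- t) c) = 0 -> frame (s ++ t).
Proof.
move=> fs ft st; have [s1 s2] := frame_sum fs; have [t1 t2] := frame_sum ft.
case: fs ft => [fs1 fs2] [ft1 ft2]; split.
  by move=> c; rewrite mem_cat => /orP[/fs1|/ft1].
rewrite pairwise_cat fs2 ft2 !andbT; apply/allrelP => c d cs dt.
apply/eqP; apply: (peirce10 s1 (s2 _ cs)).
by rewrite jmulC; apply: (peirce10 t1 (t2 _ dt)); rewrite jmulC.
Qed.

(** The Peirce space as a subspace: its dimension is the induction measure of
    the spectral theorem. *)
Definition peirce1 q : {vspace E} := lker (linfun (jmul q \- idfun)).

Lemma mem_peirce1 q y : (y \in peirce1 q) = (q ** y == y).
Proof. by rewrite memv_ker lfunE /= subr_eq0. Qed.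

Lemma peirce1_ltn q a : idem q -> idem a -> q ** a = a -> a != q ->
  (\dim (peirce1 a) < \dim (peirce1 q))%N.
Proof.
move=> qq aa qa aq.
have sub : (peirce1 a <= peirce1 q)%VS.
  apply/subvP => y; rewrite !mem_peirce1 => /eqP ay; apply/eqP.
  exact: peirce1_sub ay.
rewrite (ltn_leqif (dimv_leqif_sup sub)); apply/negP => /subvP /(_ q).
by rewrite !mem_peirce1 qq eqxx (jmulC a q) qa (negPf aq) => /(_ isT).
Qed.

(** If [q] is not primitive it splits compatibly with [x]: if [x] is no multiple
    of [q], its eigen-idempotent splits both, and if it is one, any decomposition
    of [q] will do. *)
Lemma spectral_split q x : idem q -> q != 0 -> q ** x = x ->
  (exists k, primitive_idempotent jmul q /\ x = k *: q) \/
  exists a b y z, [/\ idem a, idem b, a ** b = 0, (a != 0) && (b != 0) & q = a + b] /\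
    [/\ a ** y = y, b ** z = z & x = y + z].
Proof.
move=> qq q0 qx.
have [pq|npq] := pselect (primitive_idempotent jmul q).
  by have [k ->] := primitive_peirce1 pq qx; left; exists k.
right; have [[k xk]|nk] := pselect (exists k, x = k *: q).
  have [a [b [[aa a0] [bb b0] ab qE]]] : exists a b,
      [/\ idem a /\ a != 0, idem b /\ b != 0, a ** b = 0 & q = a + b].
    by apply: contrapT => h; apply: npq.
  exists a, b, (k *: a), (k *: b); split; split=> //; rewrite ?a0 // ?jmulE ?aa ?bb //.
  by rewrite -scalerDr -qE.
have [a [k [aa a0 qa xa]]] := eigen_idempotent qq qx q0.
have [h1 h2 _] := idem_compl qq aa qa.
have aq : a != q by apply/eqP => aq; apply: nk; exists k; rewrite -aq -xa aq jmulC.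
exists a, (q - a), (k *: a), (x - k *: a); split; split=> //.
- by rewrite a0 subr_eq0 eq_sym.
- by rewrite addrC subrK.
- by rewrite jmulE aa.
- rewrite !jmulE qx qa aa (jmulC a x) xa.
  by apply: inner_inj => t; rewrite !innerE; lra.
- by rewrite addrC subrK.
Qed.

Lemma spectral_peirce1 q x : idem q -> q ** x = x ->
  exists s : seq (R * E), [/\ frame (unzip2 s), \sum_(c <- unzip2 s) c = q
    & x = \sum_(p <- s) p.1 *: p.2].
Proof.
have [n] := ubnP (\dim (peirce1 q)); elim: n q x => // n IH q x; rewrite ltnS => qn qq qx.
have [q0|q0] := eqVneq q 0.
  by exists [::]; split=> //; rewrite ?big_nil ?q0 // -qx q0 jmul0l.
have [[k [pq ->]]|] := spectral_split qq q0 qx.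
  exists [:: (k, q)]; split; rewrite ?big_seq1 //=; split=> // c; rewrite inE => /eqP-> //.
move=> [a [b [y [z [[aa bb ab /andP[a0 b0] qE] [ay bz xE]]]]]].
have qa : q ** a = a by rewrite qE jmulE aa (jmulC b a) ab addr0.
have qb : q ** b = b by rewrite qE jmulE bb ab add0r.
have [|s [s1 s2 s3]] := IH a y _ aa ay.
  apply: leq_trans qn; apply: peirce1_ltn => //.
  by apply: contraNneq b0 => aq; rewrite -(addrK a b) (addrC b) -qE aq subrr.
have [|t [t1 t2 t3]] := IH b z _ bb bz.
  apply: leq_trans qn; apply: peirce1_ltn => //.
  by apply: contraNneq a0 => bq; rewrite -(addrK b a) -qE bq subrr.
exists (s ++ t); rewrite /unzip2 map_cat !big_cat /= -s3 -t3 s2 t2; split=> //.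
by apply: frame_cat => //; rewrite s2 t2.
Qed.

(** * The algebra below two orthogonal primitive idempotents *)

(** The algebra E_1(a + b) behaves like the symmetric 2 x 2 matrices: every
    element satisfies a quadratic equation, so [a + b] is no sum of three
    orthogonal nonzero idempotents. *)
Section RankTwo.
Context (a b : E) (pa : primitive_idempotent jmul a) (pb : primitive_idempotent jmul b).
Context (ab : a ** b = 0).
Context (q : E) (qE : q = a + b).

Let aa : idem a. Proof. by case: pa. Qed.
Let bb : idem b. Proof. by case: pb. Qed.
Let ba : b ** a = 0. Proof. by rewrite jmulC. Qed.
Let abC w : b ** (a ** w) = a ** (b ** w).
Proof. exact: (peirce0_comm w bb ba). Qed.

Lemma rank2_idem : idem q.
Proof. by rewrite /idempotent_elt qE !jmulE aa bb ab ba addr0 add0r. Qed.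

(** Since [q] acts as the identity on [y], expanding (2 q^2 - q) y with q = a + b
    splits [y] into its projections on the lines E_1(a), E_1(b) and its component
    4 a (b y) in E_ab. *)
Lemma rank2_decomp y : q ** y = y ->
  exists k l, y = k *: a + l *: b + 4 *: (a ** (b ** y)).
Proof.
move=> qy.
have [k kE] := primitive_peirce1 pa (peirce1_proj y aa).
have [l lE] := primitive_peirce1 pb (peirce1_proj y bb).
exists k, l; rewrite -kE -lE; move: qy; rewrite qE jmulDl => qy.
have qqy : a ** y + b ** y = a ** (a ** y) + 2 *: (a ** (b ** y)) + b ** (b ** y).
  rewrite -[in LHS]qy !jmulE abC.
  by apply: inner_inj => t; rewrite !innerE; lra.
apply: inner_inj => t; rewrite -{1}qy.
have := congr1 (inner ^~ t) qqy; rewrite /= !innerE; lra.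
Qed.

(** Multiplications by [a] and by [u ** u] commute, so the component of [u ** u]
    in E_ab, which is 4 a ((u u) b) = 4 (u u) (a b), vanishes.  In the remaining
    expression u u = s a + t b, the Jordan identity u ((u u) u) = (u u) (u u)
    forces s = t. *)
Lemma rank2_half u : a ** u = 2^-1 *: u -> b ** u = 2^-1 *: u ->
  exists s, u ** u = s *: q.
Proof.
move=> au bu.
have qu : q ** u = u.
  by rewrite qE jmulDl au bu; apply: inner_inj => t; rewrite !innerE; lra.
have [s [t uu]] := rank2_decomp (peirce1_mul rank2_idem qu qu).
have abuu : a ** ((u ** u) ** b) = 0.
  have := jordan_lin a u b; rewrite ab jmul0r add0r au !jmulE scalerA.
  by rewrite mulfV ?pnatr_eq0 // scale1r -[RHS]add0r => /addIr.
rewrite (jmulC b) abuu scaler0 addr0 in uu.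
have uuu : (u ** u) ** u = ((s + t) / 2) *: u.
  rewrite uu !jmulE au bu.
  by apply: inner_inj => v; rewrite !innerE; field.
have := jordan u u; rewrite uuu jmulZr uu !jmulE aa bb ab ba !scaler0 addr0 add0r => e.
have iab : inner a b = 0 by rewrite -[a in LHS]aa jmul_adj ab inner0r.
have [/inner_gt0 a1 /inner_gt0 b1] : a != 0 /\ b != 0 by case: pa; case: pb.
have e1 : (s + t) / 2 * s = s * s.
  apply/(mulIf (lt0r_neq0 a1)); have := congr1 (inner ^~ a) e.
  by rewrite /= !innerE (innerC b) iab !mulr0 !addr0 !mulrA.
have e2 : (s + t) / 2 * t = t * t.
  apply/(mulIf (lt0r_neq0 b1)); have := congr1 (inner ^~ b) e.
  by rewrite /= !innerE iab !mulr0 !add0r !mulrA.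
have st : s = t.
  apply/eqP; rewrite -subr_eq0 -sqrf_eq0; apply/eqP.
  have -> : (s - t) ^+ 2 = 2 * (s * s - (s + t) / 2 * s + (t * t - (s + t) / 2 * t)) by field.
  by rewrite e1 e2 !subrr addr0 mulr0.
by exists s; rewrite st qE -scalerDr.
Qed.

Lemma rank2_quad y : q ** y = y -> exists s t, y ** y = s *: y + t *: q.
Proof.
move=> qy; have [k [l yE]] := rank2_decomp qy.
set u := 4 *: _ in yE.
have au : a ** u = 2^-1 *: u.
  by rewrite /u jmulE orth_half // !scalerA mulrC.
have bu : b ** u = 2^-1 *: u.
  by rewrite /u jmulE -abC orth_half // !scalerA mulrC.
move: u yE au bu => u yE au bu; have [s uu] := rank2_half au bu.
exists (k + l), (s - k * l); rewrite {1 2}yE !jmulE uu aa bb ab ba.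
rewrite (jmulC u a) (jmulC u b) au bu yE qE.
by apply: inner_inj => t; rewrite !innerE; field.
Qed.

(** If [f] split as [h + i], the element [h - g], with the distinct eigenvalues
    1, 0 and -1 on [h], [i] and [g], would satisfy no quadratic equation. *)
Lemma rank2_primitive f g : idem f -> idem g -> f != 0 -> g != 0 ->
  f ** g = 0 -> f + g = q -> primitive_idempotent jmul f.
Proof.
move=> ff gg f0 g0 fg fgq; split=> // -[h [i [[hh h0] [ii i0] hi fE]]].
have fh : f ** h = h by rewrite fE jmulE hh (jmulC i) hi addr0.
have fi : f ** i = i by rewrite fE jmulE ii hi add0r.
have hg := peirce10 ff fh fg; have ig := peirce10 ff fi fg.
have gh : g ** h = 0 by rewrite jmulC.
have gi : g ** i = 0 by rewrite jmulC.
have ih : i ** h = 0 by rewrite jmulC.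
have qw : q ** (h - g) = h - g.
  by rewrite -fgq fE !jmulE hh gg hg gh ih ig !oppr0 !add0r !addr0.
have [s [t e]] := rank2_quad qw.
have orth c d : idem c -> c ** d = 0 -> inner c d = 0.
  by move=> cc cd; rewrite -[c in LHS]cc jmul_adj cd inner0r.
move: e; rewrite -fgq fE !jmulE hh gg hg gh => e.
have := congr1 (inner ^~ i) e; have := congr1 (inner ^~ h) e.
have := congr1 (inner ^~ g) e.
rewrite /= !innerE (innerC g h) (innerC g i) (innerC i h).
rewrite (orth h g) // (orth i g) // (orth h i) //.
rewrite !(mulr0, mul0r, addr0, add0r, oppr0, subr0) => eg eh ei.
move/eqP: ei; rewrite eq_sym mulf_eq0 inner_eq0 (negPf i0) orbF => /eqP t0.
have := inner_gt0 h0; have := inner_gt0 g0; rewrite t0 !mul0r !addr0 in eg eh.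
nra.
Qed.

(** Let [y] be the projection of [d] on E_1(q), and diagonalize it as k f + l g.
    Then the E_fg component of [d] is that of [y], which is zero: f (g d) = 0.
    On the other hand the projection of [f] on E_1(d) is a multiple k' d of [d],
    where k' |d|^2 = <f, d>.  Pairing it with [g] gives
    k' <d, g> = 2 <d, f (g d)> = 0.  Hence <f, d> = 0 or <g, d> = 0, and
    orthogonal idempotents annihilate each other. *)
Lemma rank2_diag d : primitive_idempotent jmul d ->
  exists f g, [/\ primitive_idempotent jmul f, primitive_idempotent jmul g,
    f ** g = 0, f + g = q & g ** d = 0].
Proof.
move=> pd; have qq := rank2_idem.
have [y yd qy] : exists2 y, y = 2 *: (q ** (q ** d)) - q ** d & q ** y = y.
  by exists (2 *: (q ** (q ** d)) - q ** d) => //; exact: peirce1_proj.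
have [f [g [pf pg fg fgq [k [l yE]]]]] : exists f g, [/\ primitive_idempotent jmul f,
    primitive_idempotent jmul g, f ** g = 0, f + g = q &
    exists k l, y = k *: f + l *: g].
  have [[k yk]|nk] := pselect (exists k, y = k *: q).
    by exists a, b; split=> //; exists k, k; rewrite yk qE scalerDr.
  have q0 : q != 0 by apply/eqP => q0; apply: nk; exists 0; rewrite -qy q0 jmul0l scale0r.
  have [f [k [ff f0 qf yf]]] := eigen_idempotent qq qy q0.
  have [gg fg qg] := idem_compl qq ff qf.
  have fq : f != q by apply/eqP => fq; apply: nk; exists k; rewrite -fq -yf fq jmulC.
  have g0 : q - f != 0 by rewrite subr_eq0 eq_sym.
  have fgq : f + (q - f) = q by rewrite addrC subrK.
  have pf : primitive_idempotent jmul f by exact: rank2_primitive fgq.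
  have pg : primitive_idempotent jmul (q - f).
    by apply: (@rank2_primitive _ f) => //; rewrite ?subrK // jmulC.
  exists f, (q - f); split=> //.
  have [|l lE] := @primitive_peirce1 (q - f) (y - k *: f) pg.
    rewrite !jmulE qy qf ff (jmulC f y) yf.
    by apply: inner_inj => t; rewrite !innerE; lra.
  by exists k, l; rewrite -lE addrC subrK.
have [ff _ _] := pf; have [gg _ _] := pg; have [dd d0 _] := pd.
have gf : g ** f = 0 by rewrite jmulC.
have gfC w : g ** (f ** w) = f ** (g ** w) by exact: (peirce0_comm w gg gf).
have qf : q ** f = f by rewrite -fgq jmulE ff gf addr0.
have qg : q ** g = g by rewrite -fgq jmulE gg fg add0r.
have qfg w : q ** (f ** (g ** w)) = f ** (g ** w).
  rewrite -fgq jmulDl orth_half // -gfC orth_half // gfC -scalerDl.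
  by have -> : 2^-1 + 2^-1 = 1 :> R; [field|rewrite scale1r].
have fgd : f ** (g ** d) = 0.
  transitivity (f ** (g ** y)); last by rewrite yE !jmulE gf gg fg !jmulE !scaler0 addr0.
  have fgq' w : f ** (g ** (q ** w)) = f ** (g ** w).
    by rewrite -(peirce1_comm w qq qg) -(peirce1_comm _ qq qf) qfg.
  rewrite yd !jmulE !fgq'.
  by apply: inner_inj => t; rewrite !innerE; lra.
have [k' zE] := primitive_peirce1 pd (peirce1_proj f dd).
have zd : k' * inner d d = inner f d.
  by rewrite -innerZl -zE !innerE !jmul_adj !dd; lra.
have zg : k' * inner d g = 0.
  have h1 : inner (d ** f) (d ** g) = 0.
    by rewrite (jmulC d f) jmul_adj (jmulC d g) fgd inner0r.
  have h2 : inner (d ** f) g = 0 by rewrite (jmulC d f) jmul_adj fg inner0r.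
  by rewrite -innerZl -zE !innerE (jmul_adj d (d ** f)) h1 h2 mulr0 subrr.
have killed c : idem c -> inner c d = 0 -> c ** d = 0.
  move=> cc cd; apply: idem_inner0 => //.
  by rewrite innerC (jmulC c) jmul_adj dd.
have /eqP := zg; rewrite mulf_eq0 => /orP[/eqP k0|/eqP dg].
  exists g, f; split=> //; [by rewrite addrC|apply: killed => //].
  by rewrite -zd k0 mul0r.
by exists f, g; split=> //; apply: killed => //; rewrite innerC.
Qed.

End RankTwo.

(** * Frames avoiding given primitive idempotents *)

(** The two-dimensional lemma is applied to [c] and each entry of the list in
    turn: one of the two new idempotents is annihilated by [d] and is set aside,
    the other one goes on to meet the next entry. *)
Lemma frame_sweep d c s : primitive_idempotent jmul d -> frame (c :: s) ->
  exists c' s', [/\ frame (c' :: s'), size s' = size s,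
    c' + \sum_(b <- s') b = c + \sum_(b <- s) b & forall g, g \in s' -> g ** d = 0].
Proof.
move=> pd; elim: s c => [|b s IH] c frc; first by exists c, [::].
have /frame_cons[pc cbs /frame_cons[pb bs frs]] := frc.
have cb : c ** b = 0 by apply: cbs; rewrite mem_head.
have [f [g [pf pg fg fgE gd]]] := rank2_diag pc pb cb erefl pd.
have [[ff _ _] [gg _ _]] := (pf, pg).
have gf : g ** f = 0 by rewrite jmulC.
have killed z : z \in s -> (f + g) ** z = 0.
  by move=> zs; rewrite fgE jmulE cbs ?in_cons ?zs ?orbT // bs // addr0.
have fgi : idem (f + g) := rank2_idem pc pb cb fgE.
have fz z : z \in s -> f ** z = 0.
  by move/killed; apply: peirce10 => //; rewrite jmulE ff gf addr0.
have gz z : z \in s -> g ** z = 0.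
  by move/killed; apply: peirce10 => //; rewrite jmulE gg fg add0r.
have [|c' [s' [frc' ss' sE sd]]] := IH f; first exact/frame_cons.
have [S1 S2] := frame_sum frc'.
have Sg : (\sum_(b <- c' :: s') b) ** g = 0.
  by rewrite big_cons sE jmulC jmulE gf orth_sum0 // addr0.
have orthg z : z \in c' :: s' -> z ** g = 0 by move/S2 => h; apply: peirce10 Sg.
have /frame_cons[pc' c's' frs'] := frc'.
exists c', (g :: s'); split.
- apply/frame_cons; split=> //.
    move=> z; rewrite in_cons => /orP[/eqP->|]; last exact: c's'.
    by apply: orthg; rewrite mem_head.
  apply/frame_cons; split=> // z zs'.
  by rewrite jmulC orthg // in_cons zs' orbT.
- by rewrite /= ss'.
- by rewrite !big_cons addrCA sE addrCA addrA fgE addrA.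
- by move=> z; rewrite in_cons => /orP[/eqP->|/sd].
Qed.

(** Each primitive idempotent [d] costs one element of the frame: by
    [frame_sweep] all but one of its elements can be chosen annihilated by [d],
    and then so is everything in the Peirce space of their sum. *)
Lemma frame_avoid s ds : frame s ->
  (forall d, d \in ds -> primitive_idempotent jmul d) -> (size ds < size s)%N ->
  exists z, [/\ primitive_idempotent jmul z, (\sum_(c <- s) c) ** z = z
    & forall d, d \in ds -> z ** d = 0].
Proof.
elim: ds s => [|d ds IH] [|c s] // frs pds.
  move=> _; exists c; split=> //.
    by case: frs => h _; apply/h/mem_head.
  by have [_ ->] := frame_sum frs; rewrite ?mem_head.
rewrite /= ltnS => dss.
have pd : primitive_idempotent jmul d by apply/pds/mem_head.
have [c' [s' [/frame_cons[pc' c's' frs'] ss' sE sd]]] := frame_sweep pd frs.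
have [//|x xds||z [pz Sz zd]] := IH s'.
- by apply: pds; rewrite in_cons xds orbT.
- by rewrite ss'.
have [S1 _] := frame_sum frs'.
exists z; split=> //.
  rewrite big_cons -sE jmulE Sz [X in X + _](_ : _ = 0) ?add0r //.
  by rewrite jmulC; apply: (peirce10 S1 Sz); rewrite jmulC orth_sum0.
move=> x; rewrite in_cons => /orP[/eqP->|/zd //].
apply: (peirce10 S1 Sz); rewrite jmulC orth_sum0 // => g /sd.
by rewrite jmulC.
Qed.

(** * Extreme rays of the cone of squares *)

Section Cone.
Context (K : set E) (e : E) (symK : symmetric_cone K) (unit_e : jordan_identity jmul e).
Context (sqK : K = cone_of_squares jmul).

Lemma cone_add x y : K x -> K y -> K (x + y).
Proof.
case: symK => _ _ -> _ _ Kx Ky z Kz.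
by rewrite innerDl addr_ge0 ?Kx ?Ky.
Qed.

Lemma cone_scale k x : 0 <= k -> K x -> K (k *: x).
Proof. by case: symK => _ [_ h] _ _ _; exact: h. Qed.

Lemma cone_idem c : idem c -> K c.
Proof. by rewrite sqK => cc; exists c. Qed.

Lemma cone_zero : K 0.
Proof. by rewrite sqK; exists 0 => //; rewrite jmul0l. Qed.

Lemma cone_sum I r (P : pred I) (F : I -> E) :
  (forall i, P i -> K (F i)) -> K (\sum_(i <- r | P i) F i).
Proof. by move=> h; apply: big_ind => //; [exact: cone_zero|exact: cone_add]. Qed.

Lemma inner_idem_ge0 x c : idem c -> K x -> 0 <= inner x c.
Proof.
rewrite sqK => cc [w _ <-]; rewrite jmul_adj (jmulC w c); exact: idem_ge0.
Qed.

Lemma inner_idem_eq0 w c : idem c -> inner (w ** w) c = 0 -> c ** w = 0.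
Proof. by move=> cc; rewrite jmul_adj (jmulC w c) => /idem_inner0 ->. Qed.

Definition ray c : set E := [set y | exists2 t, 0 <= t & y = t *: c].

(** If [t *: c] is a convex combination of [u] and [v] in the cone, both are
    orthogonal to [e - c], because [c] is.  Writing u = w w, this gives
    (e - c) w = 0, so that [w] is in E_1(c), the line of [c]. *)
Lemma ray_face c : primitive_idempotent jmul c -> face K (ray c).
Proof.
move=> pc; have [cc c0 _] := pc; split.
- move=> _ _ l /set_mem[s s0 ->] /set_mem[t t0 ->]; apply/mem_set.
  exists (l%:num * s + (1 - l%:num) * t).
    by rewrite addr_ge0 ?mulr_ge0 // subr_ge0.
  by rewrite scalerDl -!scalerA.
- by move=> _ [t t0 ->]; apply: cone_scale => //; exact: cone_idem.
have [gg cg _] : [/\ idem (e - c), c ** (e - c) = 0 & e ** (e - c) = e - c].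
  by apply: idem_compl; rewrite /idempotent_elt ?unit_e.
have key u : K u -> inner u (e - c) = 0 -> ray c u.
  rewrite sqK => -[w _ <-] /(inner_idem_eq0 gg); rewrite !jmulE unit_e => /eqP.
  rewrite subr_eq0 eq_sym => /eqP /(primitive_peirce1 pc)[k ->].
  by exists (k * k); rewrite ?sqr_ge0 // !jmulE cc scalerA.
move=> u v a Ku Kv a0 a1 [t t0 uv].
have Hc : inner c (e - c) = 0 by rewrite -{1}cc jmul_adj cg inner0r.
have := congr1 (inner ^~ (e - c)) uv; rewrite /= innerDl !innerZl Hc mulr0.
have a1' : 0 < 1 - a by rewrite subr_gt0.
have hu := inner_idem_ge0 gg Ku; have hv := inner_idem_ge0 gg Kv.
move/eqP; rewrite paddr_eq0 ?mulr_ge0 ?(ltW a0) ?(ltW a1') //.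
rewrite !mulf_eq0 (gt_eqF a0) (gt_eqF a1') /= => /andP[/eqP eu /eqP ev].
by split; apply: key.
Qed.

Lemma ray_extreme c : primitive_idempotent jmul c -> extreme_ray K (ray c).
Proof.
move=> pc; split; first exact: ray_face.
have [_ c0 _] := pc; split; first by exists 0, 0 => //; rewrite scale0r.
exists <[c]>%VS; split; first by rewrite dim_vline c0.
  by move=> _ _ [s _ ->] [t _ ->]; rewrite -scalerBl memvZ ?memv_line.
move=> W h; rewrite -memvE -[c]subr0; apply: h.
  by exists 1; rewrite ?scale1r.
by exists 0; rewrite ?scale0r.
Qed.

Lemma spectral_exists x : exists l, spectral_values jmul e x l.
Proof.
have ee : idem e by rewrite /idempotent_elt unit_e.
have [s [[s1 s2] s3 s4]] := spectral_peirce1 ee (unit_e x).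
have sz : size (unzip2 s) = size s by rewrite size_map.
exists (unzip1 s); exists (fun i => (unzip2 s)`_i); rewrite size_map; split; first split.
- by move=> i; apply: s1; rewrite mem_nth // sz.
- have ord (i j : 'I_(size s)) : (i < j)%N -> (unzip2 s)`_i ** (unzip2 s)`_j = 0.
    by move=> ij; apply/eqP; apply: (pairwiseP 0 s2); rewrite ?inE ?sz.
  move=> i j; rewrite neq_ltn => /orP[/ord //|/ord]; by rewrite jmulC.
- by rewrite -s3 (big_nth 0) sz big_mkord.
rewrite s4 (big_nth (0, 0)) big_mkord; apply: eq_bigr => i _.
by rewrite !(nth_map (0, 0)).
Qed.

Lemma frame_inner n (c : 'I_n -> E) : jordan_frame jmul e c ->
  forall i j, inner (c i) (c j) = if i == j then inner (c i) (c i) else 0.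
Proof.
move=> [pc oc _] i j; case: eqVneq => [->//|ij]; have [cc _ _] := pc i.
by rewrite -[c i in LHS]cc jmul_adj oc // inner0r.
Qed.

(** If x is the sum then l_i |c_i|^2 = <x, c_i>, and both x and [c i] are in the
    cone. *)
Lemma spectral_ge0 n (c : 'I_n -> E) (l : 'I_n -> R) : jordan_frame jmul e c ->
  K (\sum_(i < n) l i *: c i) -> forall i, 0 <= l i.
Proof.
move=> fc Kx i; have [pc _ _] := fc; have [cc c0 _] := pc i.
have := inner_idem_ge0 cc Kx; rewrite innerC inner_sumr (bigD1 i) //= big1.
  by rewrite addr0 innerZr pmulr_lge0 // inner_gt0.
by move=> j ji; rewrite innerZr (frame_inner fc) eq_sym (negPf ji) mulr0.
Qed.

(** Some term of the spectral decomposition of [d] is nonzero.  As [d] is the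
    midpoint of twice this term and twice the remaining terms, the face [F]
    contains twice this term, and it contains 0 likewise.  Being of dimension
    one, [F] lies on the line of this term. *)
Lemma extreme_multiple F d : extreme_ray K F -> F d -> d != 0 ->
  exists c k, primitive_idempotent jmul c /\ d = k *: c.
Proof.
move=> [[_ FK Fface] [_ [U [dU UF _]]]] Fd d0.
have [l [c [fc dE]]] := spectral_exists d.
have [pc _ _] := fc.
have l0 : forall i : 'I_(size l), 0 <= l`_i.
  by apply: (spectral_ge0 fc); rewrite -dE; exact: FK.
have [i li] : exists i : 'I_(size l), l`_i != 0.
  apply: contrapT => h; case/eqP: d0; rewrite dE big1 // => i _.
  have [->|li] := eqVneq l`_i 0; first by rewrite scale0r.
  by case: h; exists i.
have Kc (j : 'I_(size l)) : K (l`_j *: c j).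
  by apply: cone_scale => //; apply: cone_idem; case: (pc j).
have half (u v : E) : u + v = 2^-1 *: (2 *: u) + (1 - 2^-1) *: (2 *: v).
  by apply: inner_inj => t; rewrite !innerE; field.
have h0 : 0 < 2^-1 :> R by rewrite invr_gt0 ltr0n.
have h1 : 2^-1 < 1 :> R by rewrite invf_lt1 ?ltr0n // ltr1n.
have [_ F0] : F (2 *: d) /\ F (2 *: 0).
  apply: (Fface _ _ _ _ _ h0 h1); rewrite -?half ?addr0 //.
    by apply: cone_scale => //; exact: FK.
  by rewrite scaler0; exact: cone_zero.
have [Fc _] : F (2 *: (l`_i *: c i)) /\ F (2 *: \sum_(j < size l | j != i) l`_j *: c j).
  apply: (Fface _ _ _ _ _ h0 h1); rewrite -?half.
  - by apply: cone_scale.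
  - by apply: cone_scale => //; apply: cone_sum => j _.
  - by rewrite -(bigD1 i (P := xpredT)) //= -dE.
rewrite scaler0 in F0.
have cU : c i \in U.
  have := UF _ _ Fc F0; rewrite subr0 scalerA => /(memvZ (2 * l`_i)^-1).
  by rewrite scalerA mulVf ?scale1r // mulf_neq0 // pnatr_eq0.
have c0 : c i != 0 by case: (pc i).
have UE : (<[c i]> == U)%VS by rewrite eqEdim -memvE cU dim_vline c0 dU.
have := UF _ _ Fd F0; rewrite subr0 -(eqP UE) => /vlineP[k dk].
by exists (c i), k.
Qed.

Lemma extreme_sum_seq (t : seq E) :
  (forall d, d \in t -> exists F, extreme_ray K F /\ F d) ->
  extreme_sum K (\sum_(d <- t) d) (size t).
Proof.
move=> h; exists (fun i : 'I_(size t) => t`_i); split=> [i|].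
  by apply: h; rewrite mem_nth.
by rewrite (big_nth 0) big_mkord.
Qed.

Section Support.
Context (l : seq R) (c : 'I_(size l) -> E) (fc : jordan_frame jmul e c).
Let supp := [seq i : 'I_(size l) <- enum 'I_(size l) | l`_i != 0].
Let x := \sum_(i < size l) l`_i *: c i.
Context (Kx : K x).

Lemma size_supp : size supp = count (fun t => t != 0) l.
Proof.
rewrite size_filter -[in RHS](mkseq_nth 0 l) /mkseq [RHS]count_map.
rewrite -val_enum_ord [RHS]count_map.
exact: eq_count.
Qed.

Lemma supp_sum : \sum_(d <- [seq l`_i *: c i | i : 'I_(size l) <- supp]) d = x.
Proof.
rewrite big_map big_filter big_enum_cond big_mkcond; apply: eq_bigr => i _ /=.
by case: eqVneq => [->|//]; rewrite scale0r.
Qed.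

Lemma supp_frame : frame [seq c i | i : 'I_(size l) <- supp].
Proof.
have [pc oc _] := fc; split=> [_ /mapP[i _ ->] //|].
rewrite pairwise_map; apply: pairwise_filter.
have := enum_uniq 'I_(size l); rewrite uniq_pairwise; apply: sub_pairwise => i j ij /=.
by rewrite oc.
Qed.

Lemma extreme_sum_rank : extreme_sum K x (count (fun t => t != 0) l).
Proof.
rewrite -size_supp -supp_sum -(size_map (fun i : 'I_(size l) => l`_i *: c i)).
apply: extreme_sum_seq => _ /mapP[i _ ->]; exists (ray (c i)); split.
  by apply: ray_extreme; case: fc.
by exists (l`_i) => //; exact: (spectral_ge0 fc Kx).
Qed.

(** With fewer summands than nonzero eigenvalues, [frame_avoid] gives a nonzero
    idempotent [z] below the support of [x] that annihilates all the summands,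
    so that <z, x> = 0.  The spectral decomposition writes this number as a sum
    of nonnegative terms, hence [z] is orthogonal to the sum p of the [c i] in the
    support.  But <z, p> = |z|^2, as p z = z. *)
Lemma rank_le_extreme_sum m : extreme_sum K x m ->
  (count (fun t => t != 0%R) l <= m)%N.
Proof.
move=> [d [dF xd]]; rewrite leqNgt -size_supp; apply/negP => ms.
have [pc oc _] := fc.
have /hasP[i0 _ _] : has xpredT supp by rewrite has_predT (leq_ltn_trans _ ms).
(* A zero summand is a multiple of any primitive idempotent; the support, being
   nonempty, provides one. *)
have /choice[p pP] : forall i, exists c',
    primitive_idempotent jmul c' /\ exists k, d i = k *: c'.
  move=> i; have [->|di] := eqVneq (d i) 0.
    by exists (c i0); split=> //; exists 0; rewrite scale0r.
  have [F [EF Fd]] := dF i; have [c' [k [pc' dE]]] := extreme_multiple EF Fd di.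
  by exists c'; split=> //; exists k.
have [||z [pz Sz zd]] := frame_avoid (ds := [seq p i | i <- enum 'I_m]) supp_frame.
- by move=> _ /mapP[i _ ->]; case: (pP i).
- by rewrite (size_map p) (size_map c) size_enum_ord.
have [zz z0 _] := pz.
have zx : inner z x = 0.
  have -> : inner z x = inner z (z ** x) by rewrite -jmul_adj zz.
  rewrite xd jmul_sumr big1 ?inner0r // => i _.
  have [_ [k ->]] := pP i; rewrite jmulE zd ?scaler0 //.
  by apply: map_f; rewrite mem_enum.
have terms (i : 'I_(size l)) : 0 <= l`_i * inner z (c i).
  apply: mulr_ge0; first exact: (spectral_ge0 fc Kx).
  by apply: inner_idem_ge0; [case: (pc i)|exact: cone_idem].
move: zx; rewrite inner_sumr; under eq_bigr do rewrite innerZr.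
move/eqP; rewrite psumr_eq0 // => /allP zc.
have := inner_gt0 z0; rewrite -{2}Sz jmulC -jmul_adj zz inner_sumr big_map.
rewrite big1_seq ?ltxx // => i /andP[_]; rewrite mem_filter => /andP[li _].
by have := zc i; rewrite mem_index_enum mulf_eq0 (negPf li) => /(_ isT)/eqP.
Qed.

End Support.

End Cone.

End EuclideanJordan.

(** * The Caratheodory number is the rank *)

Theorem theorem19 (R : realType) (E : euclideanType R) (K : set E)
    (symK : symmetric_cone K)
    (jmul : {bilinear E -> E -> E}) (e : E)
    (ejaE : euclidean_jordan jmul)
    (unit_e : jordan_identity jmul e)
    (sqK : K = cone_of_squares jmul)
    (x : E) (Kx : K x) :
  kappa K x = jordan_rank jmul e x.
Proof.
have [c [fc xE]] : spectral_values jmul e x (eigenvalues jmul e x).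
  exact: (xgetPex [::] (spectral_exists ejaE unit_e x)).
rewrite xE in Kx.
have ge_rank m : extreme_sum K x m -> (jordan_rank jmul e x <= m)%N.
  rewrite {1}xE; exact: (rank_le_extreme_sum ejaE symK unit_e sqK fc Kx).
have sum_rank : extreme_sum K x (jordan_rank jmul e x).
  rewrite {1}xE; exact: (extreme_sum_rank ejaE symK unit_e sqK fc Kx).
apply: xget_unique => // k [sumk mink].
by apply/eqP; rewrite eqn_leq mink // ge_rank.
Qed.
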